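(* It is consistent with $\mathbf{CZF}$ to assume that the only injective sets are the singletons: if $\mathbf{CZF}$ is consistent, then so is $\mathbf{CZF}$ together with the statement ''a set is injective if and only if it is a singleton''. In particular, if $\mathbf{CZF}$ is consistent, then $\mathbf{CZF}$ does not prove the statement ''there are enough injective sets''.
   Context: $\mathbf{CZF}$ is Aczel's constructive Zermelo–Fraenkel set theory: intuitionistic first-order logic with equality in the language of set theory, with the axioms of extensionality, pairing, union, restricted ($\Delta_0$) separation, strong infinity, strong collection, subset collection, and set induction. It has no power set axiom; adding excluded middle yields $\mathbf{ZF}$. A set $E$ is injective if every map with codomain $E$ can be extended to any superset of its domain: for all sets $X\subseteq Y$ and every map $f:X\to E$ there is a map $g:Y\to E$ with $g|_X=f$. There are enough injective sets if every set is the domain of an embedding (injective map) whose codomain is an injective set. A known result from the literature that the paper relies on is that the General Uniformity Principle, i.e. the scheme $\forall x\,\exists y\in a\,\varphi(x,y)\rightarrow\exists y\in a\,\forall x\,\varphi(x,y)$ (with $x$ ranging over all sets), is consistent with $\mathbf{CZF}$. *)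

(* Defs.v *)
(** Intuitionistic first-order logic with equality over the signature of set
    theory, the theory CZF, and the set-theoretic formulas needed to speak of
    injective sets.  Uses only Stdlib. *)

From Stdlib Require Import List.
Import ListNotations.

(** Variables are de Bruijn indices; since the signature has no function
    symbols, variables are the only terms and substitution is renaming. *)
Inductive form : Type :=
| Bot : form
| Eq : nat -> nat -> form
| Mem : nat -> nat -> form
| And : form -> form -> form
| Or : form -> form -> form
| Imp : form -> form -> form
| All : form -> form
| Ex : form -> form.

Declare Scope form_scope.
Delimit Scope form_scope with form.
Bind Scope form_scope with form.

Definition Iff (phi psi : form) : form := And (Imp phi psi) (Imp psi phi).

(** [y] lives outside the bounded quantifier, whose body sees it as [S y]. *)
Definition BAll (y : nat) (phi : form) : form := All (Imp (Mem 0 (S y)) phi).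
Definition BEx (y : nat) (phi : form) : form := Ex (And (Mem 0 (S y)) phi).

Notation "⊥" := Bot : form_scope.
Notation "x ≐ y" := (Eq x y) (at level 70, no associativity) : form_scope.
Notation "x ∈ y" := (Mem x y) (at level 70, no associativity) : form_scope.
Notation "phi ∧ psi" := (And phi psi)
  (at level 80, right associativity) : form_scope.
Notation "phi ∨ psi" := (Or phi psi)
  (at level 85, right associativity) : form_scope.
Notation "phi ⟶ psi" := (Imp phi psi)
  (at level 90, right associativity) : form_scope.
Notation "phi ⟷ psi" := (Iff phi psi)
  (at level 95, no associativity) : form_scope.
Notation "∀' phi" := (All phi) (at level 75, right associativity) : form_scope.
Notation "∃' phi" := (Ex phi) (at level 75, right associativity) : form_scope.
Notation "∀∈ y , phi" := (BAll y phi)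
  (at level 75, y at level 9, phi at level 75) : form_scope.
Notation "∃∈ y , phi" := (BEx y phi)
  (at level 75, y at level 9, phi at level 75) : form_scope.

Definition up (rho : nat -> nat) (n : nat) : nat :=
  match n with 0 => 0 | S m => S (rho m) end.

Fixpoint rename (rho : nat -> nat) (phi : form) : form :=
  match phi with
  | Bot => Bot
  | Eq x y => Eq (rho x) (rho y)
  | Mem x y => Mem (rho x) (rho y)
  | And a b => And (rename rho a) (rename rho b)
  | Or a b => Or (rename rho a) (rename rho b)
  | Imp a b => Imp (rename rho a) (rename rho b)
  | All a => All (rename (up rho) a)
  | Ex a => Ex (rename (up rho) a)
  end.

(** [x0, ..., x(m-1)] replace the variables [0, ..., m-1]; the variable [m + i]
    becomes [k + i]. *)
Fixpoint inst (xs : list nat) (k n : nat) : nat :=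
  match xs, n with
  | [], _ => k + n
  | x :: _, 0 => x
  | _ :: xs', S n' => inst xs' k n'
  end.

Definition sub (xs : list nat) (k : nat) (phi : form) : form :=
  rename (inst xs k) phi.

(** [shift] renames every free [n] to [S n]; [phi.[t]] replaces the variable
    [0] by [t] and lowers all others by one. *)
Definition shift (phi : form) : form := sub [] 1 phi.
Notation "phi .[ t ]" := (sub [t] 0 phi)
  (at level 2, left associativity, format "phi .[ t ]") : form_scope.

(** The least [b] such that every free variable is [< b]. *)
Fixpoint bound (phi : form) : nat :=
  match phi with
  | Bot => 0
  | Eq x y | Mem x y => S (max x y)
  | And a b | Or a b | Imp a b => max (bound a) (bound b)
  | All a | Ex a => pred (bound a)
  end.

Definition closure (phi : form) : form := Nat.iter (bound phi) All phi.

(** Natural deduction. *)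
Inductive prv : list form -> form -> Prop :=
| prv_hyp G phi : In phi G -> prv G phi
| prv_botE G phi : prv G Bot -> prv G phi
| prv_andI G phi psi : prv G phi -> prv G psi -> prv G (And phi psi)
| prv_andE1 G phi psi : prv G (And phi psi) -> prv G phi
| prv_andE2 G phi psi : prv G (And phi psi) -> prv G psi
| prv_orI1 G phi psi : prv G phi -> prv G (Or phi psi)
| prv_orI2 G phi psi : prv G psi -> prv G (Or phi psi)
| prv_orE G phi psi chi :
    prv G (Or phi psi) -> prv (phi :: G) chi -> prv (psi :: G) chi -> prv G chi
| prv_impI G phi psi : prv (phi :: G) psi -> prv G (Imp phi psi)
| prv_impE G phi psi : prv G (Imp phi psi) -> prv G phi -> prv G psi
| prv_allI G phi : prv (map shift G) phi -> prv G (All phi)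
| prv_allE G phi t : prv G (All phi) -> prv G phi.[t]
| prv_exI G phi t : prv G phi.[t] -> prv G (Ex phi)
| prv_exE G phi chi :
    prv G (Ex phi) -> prv (phi :: map shift G) (shift chi) -> prv G chi
| prv_eqI G x : prv G (Eq x x)
| prv_eqE G phi x y : prv G (Eq x y) -> prv G phi.[x] -> prv G phi.[y].

Definition theory : Type := form -> Prop.

Definition proves (T : theory) (phi : form) : Prop :=
  exists G : list form, (forall psi, In psi G -> T psi) /\ prv G phi.

Definition consistent (T : theory) : Prop := ~ proves T Bot.

Definition extend (T : theory) (phi : form) : theory :=
  fun psi => T psi \/ psi = phi.

Inductive Delta0 : form -> Prop :=
| Delta0_bot : Delta0 Bot
| Delta0_eq x y : Delta0 (Eq x y)
| Delta0_mem x y : Delta0 (Mem x y)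
| Delta0_and phi psi : Delta0 phi -> Delta0 psi -> Delta0 (And phi psi)
| Delta0_or phi psi : Delta0 phi -> Delta0 psi -> Delta0 (Or phi psi)
| Delta0_imp phi psi : Delta0 phi -> Delta0 psi -> Delta0 (Imp phi psi)
| Delta0_ball y phi : Delta0 phi -> Delta0 (BAll y phi)
| Delta0_bex y phi : Delta0 phi -> Delta0 (BEx y phi).

(** The comments below list, innermost binder first, the names of the
    variables [0, 1, ...] in scope.  In the schemes the remaining free
    variables of the formula are parameters, and [closure] quantifies them. *)
Local Open Scope form_scope.

(** ∀a ∀b (∀x (x ∈ a ↔ x ∈ b) → a = b);  x, b, a *)
Definition extensionality : form :=
  ∀' ∀' ((∀' (0 ∈ 2 ⟷ 0 ∈ 1)) ⟶ 1 ≐ 0).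

(** ∀a ∀b ∃c ∀x (x ∈ c ↔ x = a ∨ x = b);  x, c, b, a *)
Definition pairing : form :=
  ∀' ∀' ∃' ∀' (0 ∈ 1 ⟷ (0 ≐ 3 ∨ 0 ≐ 2)).

(** ∀a ∃c ∀x (x ∈ c ↔ ∃u ∈ a, x ∈ u);  u, x, c, a *)
Definition union : form :=
  ∀' ∃' ∀' (0 ∈ 1 ⟷ ∃∈ 2, (1 ∈ 0)).

(** phi(x);  ∀a ∃c ∀x (x ∈ c ↔ x ∈ a ∧ phi(x));  x, c, a *)
Definition separation (phi : form) : form :=
  ∀' ∃' ∀' (0 ∈ 1 ⟷ (0 ∈ 2 ∧ sub [0] 3 phi)).

(** t = s ∪ {s} *)
Definition is_succ (t s : nat) : form :=
  ∀' (0 ∈ S t ⟷ (0 ∈ S s ∨ 0 ≐ S s)).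

Definition inductive_set (a : nat) : form :=
  (∃∈ a, ∀∈ 0, ⊥) ∧ (∀∈ a, ∃∈ (S a), is_succ 0 1).

(** ∃a (Ind(a) ∧ ∀b (Ind(b) → ∀x ∈ a, x ∈ b));  x, b, a *)
Definition strong_infinity : form :=
  ∃' (inductive_set 0 ∧ ∀' (inductive_set 0 ⟶ ∀∈ 1, (0 ∈ 1))).

(** phi(x, y);  ∀a (∀x ∈ a ∃y phi → ∃b (∀x ∈ a ∃y ∈ b phi ∧ ∀y ∈ b ∃x ∈ a phi));
    y, x, a in the premise and y, x, b, a (resp. x, y, b, a) in the conclusion *)
Definition strong_collection (phi : form) : form :=
  ∀' ((∀∈ 0, ∃' sub [1; 0] 3 phi) ⟶
      ∃' ((∀∈ 1, ∃∈ 1, sub [1; 0] 4 phi) ∧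
          (∀∈ 0, ∃∈ 2, sub [0; 1] 4 phi))).

(** phi(x, y, u);  ∀a ∀b ∃c ∀u (∀x ∈ a ∃y ∈ b phi →
      ∃d ∈ c (∀x ∈ a ∃y ∈ d phi ∧ ∀y ∈ d ∃x ∈ a phi));
    y, x, u, c, b, a in the premise and y, x, d, u, c, b, a (resp.
    x, y, d, u, c, b, a) in the conclusion *)
Definition subset_collection (phi : form) : form :=
  ∀' ∀' ∃' ∀'
    ((∀∈ 3, ∃∈ 3, sub [1; 0; 2] 6 phi) ⟶
     ∃∈ 1, ((∀∈ 4, ∃∈ 1, sub [1; 0; 3] 7 phi) ∧
            (∀∈ 0, ∃∈ 5, sub [0; 1; 3] 7 phi))).

(** phi(x);  ∀a (∀x ∈ a phi(x) → phi(a)) → ∀a phi(a);  x, a *)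
Definition set_induction (phi : form) : form :=
  (∀' ((∀∈ 0, sub [0] 2 phi) ⟶ phi)) ⟶ ∀' phi.

Inductive CZF : theory :=
| CZF_extensionality : CZF extensionality
| CZF_pairing : CZF pairing
| CZF_union : CZF union
| CZF_separation phi : Delta0 phi -> CZF (closure (separation phi))
| CZF_strong_infinity : CZF strong_infinity
| CZF_strong_collection phi : CZF (closure (strong_collection phi))
| CZF_subset_collection phi : CZF (closure (subset_collection phi))
| CZF_set_induction phi : CZF (closure (set_induction phi)).

(** z = {a, b} *)
Definition is_upair (z a b : nat) : form :=
  ∀' (0 ∈ S z ⟷ (0 ≐ S a ∨ 0 ≐ S b)).

(** p = {{x}, {x, y}} *)
Definition is_opair (p x y : nat) : form :=
  ∃' ∃' (is_upair 1 (2 + x) (2 + x) ∧ is_upair 0 (2 + x) (2 + y) ∧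
         is_upair (2 + p) 1 0).

(** ⟨x, y⟩ ∈ f *)
Definition maps (f x y : nat) : form := ∃∈ f, is_opair 0 (S x) (S y).

(** f ⊆ X × Y, and ⟨x, y⟩ ∈ f holds for exactly one y for each x ∈ X *)
Definition is_map (f X Y : nat) : form :=
  (∀∈ f, ∃∈ (1 + X), ∃∈ (2 + Y), is_opair 2 1 0) ∧
  (∀∈ X, ∃' (maps (2 + f) 1 0 ∧ ∀' (maps (3 + f) 2 0 ⟶ 0 ≐ 1))).

Definition is_subset (X Y : nat) : form := ∀∈ X, (0 ∈ S Y).

(** f = {p ∈ g | p = ⟨x, y⟩ for some x ∈ X and some y} *)
Definition is_restriction (f g X : nat) : form :=
  ∀' (0 ∈ S f ⟷ (0 ∈ S g ∧ ∃∈ (S X), ∃' is_opair 2 1 0)).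

(** ∀X ∀Y ∀f (X ⊆ Y ∧ f : X → E → ∃g (g : Y → E ∧ g|X = f));  g, f, Y, X *)
Definition is_injective (E : nat) : form :=
  ∀' ∀' ∀'
    ((is_subset 2 1 ∧ is_map 0 2 (3 + E)) ⟶
     ∃' (is_map 0 2 (4 + E) ∧ is_restriction 1 0 3)).

Definition is_singleton (E : nat) : form := ∃' ∀' (0 ∈ (2 + E) ⟷ 0 ≐ 1).

Definition is_embedding (j X Y : nat) : form :=
  is_map j X Y ∧
  ∀' ∀' ∀' ((maps (3 + j) 2 0 ∧ maps (3 + j) 1 0) ⟶ 2 ≐ 1).

Definition injective_iff_singleton : form :=
  ∀' (is_injective 0 ⟷ is_singleton 0).

(** j, E, A *)
Definition enough_injectives : form :=
  ∀' ∃' (is_injective 0 ∧ ∃' is_embedding 0 2 1).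

(* Main.v *)
From Stdlib Require Import List PeanoNat FunctionalExtensionality
  PropExtensionality ProofIrrelevance IndefiniteDescription.
Require Import Defs.
Import ListNotations.

(** Both parts follow from a realizability model of CZF in which every set is
    indexed by a set of realizers, each index naming one element, and in which
    both quantifiers are uniform: a realizer of [forall x, phi x] realizes every
    instance and does not see [x].  Hence a realizer of
    [forall x, exists y in a, phi x y] yields an index of [y] in [a] that does
    not depend on [x], which is the General Uniformity Principle.

    Let [E] be injective.  For every set [x] extend the inclusion of
    [X = {z in E | z = x}] in [E] to [g : {x} -> E].  The value [g x] is an
    element of [E], and it equals [x] if [x] is in [E].  By uniformity this
    value is the same for all [x], so [E] is a singleton.  Conversely, a map into
    [{s}] extends to [Y] by the constant map [Y * {s}].  As the set [{0, 1}] does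
    not embed in a singleton, there are not enough injective sets. *)

(** * A total combinatory algebra *)

(** Engeler's graph model: [Arrow l t] in [X] means that the operation coded by
    [X] outputs [t] as soon as its input contains [l]. *)
Inductive token : Type :=
| Atom : token
| Arrow : list token -> token -> token.

Definition realizer : Type := token -> Prop.

Definition app (X Y : realizer) : realizer :=
  fun t => exists l, X (Arrow l t) /\ forall u, In u l -> Y u.

Definition lam (f : realizer -> realizer) : realizer :=
  fun t => match t with Atom => False | Arrow l u => f (fun v => In v l) u end.

(** Scott continuity: each output token needs only finitely many input tokens. These are the maps
    that [lam] represents faithfully. *)
Definition cont (f : realizer -> realizer) : Prop :=
  forall X t, f X t <->
    exists l, (forall u, In u l -> X u) /\ f (fun v => In v l) t.

Lemma realizer_ext (X Y : realizer) : (forall t, X t <-> Y t) -> X = Y.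
Proof.
  intros H; apply functional_extensionality; intros t.
  apply propositional_extensionality, H.
Qed.

(** [lam f] records [f] on finite inputs only, and by continuity these determine [f Y]. *)
Lemma beta f Y : cont f -> app (lam f) Y = f Y.
Proof.
  intros Hf; apply realizer_ext; intros t; rewrite (Hf Y t); unfold app, lam.
  split; intros (l & H1 & H2); exists l; auto.
Qed.

Lemma cont_mono f X Y t :
  cont f -> (forall u, X u -> Y u) -> f X t -> f Y t.
Proof.
  intros Hf H HX; apply Hf in HX as (l & Hl & Ht); apply Hf; exists l; auto.
Qed.

Lemma cont_const c : cont (fun _ => c).
Proof.
  intros X t; split; [intros H; exists []; split; [intros u [] | exact H] |].
  now intros (l & _ & H).
Qed.

Lemma cont_id : cont (fun x => x).
Proof.
  intros X t; split.
  - intros H; exists [t]; split; [intros u [<- | []]; exact H | now left].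
  - intros (l & H & Ht); auto.
Qed.

Lemma cont_app f g :
  cont f -> cont g -> cont (fun x => app (f x) (g x)).
Proof.
  intros Hf Hg X t; split.
  - intros (l & H1 & H2).
    apply Hf in H1 as (l1 & Hl1 & H1).
    (* Each token of the finite list [l] needs a finite part of [X]; these parts are
       concatenated. *)
    assert (exists l2, (forall u, In u l2 -> X u) /\
      forall u, In u l -> g (fun v => In v l2) u) as (l2 & Hl2 & H3).
    { clear H1; induction l as [| a l IH].
      - exists []; split; intros u [].
      - destruct IH as (l2 & Hl2 & H3); [intros u Hu; apply H2; now right |].
        destruct (proj1 (Hg X a) (H2 a (in_eq a l))) as (l3 & Hl3 & H4).
        exists (l2 ++ l3); split.
        + intros u [Hu | Hu] %in_app_or; auto.
        + intros u [<- | Hu].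
          * refine (cont_mono _ _ _ _ Hg _ H4); intros; apply in_or_app; auto.
          * refine (cont_mono _ _ _ _ Hg _ (H3 u Hu)).
            intros; apply in_or_app; auto. }
    exists (l1 ++ l2); split.
    + intros u [Hu | Hu] %in_app_or; auto.
    + exists l; split.
      * refine (cont_mono _ _ _ _ Hf _ H1); intros; apply in_or_app; auto.
      * intros u Hu; refine (cont_mono _ _ _ _ Hg _ (H3 u Hu)).
        intros; apply in_or_app; auto.
  - intros (l & Hl & l' & H1 & H2); exists l'; split.
    + now apply (cont_mono f (fun v => In v l)).
    + intros u Hu; apply (cont_mono g (fun v => In v l)); auto.
Qed.

(** A token [Arrow l t] of the abstraction fixes [y] to the finite set [l], so continuity in [x] for
    each fixed [y] suffices. *)
Lemma cont_lam g :
  (forall y, cont (fun x => g x y)) -> cont (fun x => lam (fun y => g x y)).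
Proof.
  intros Hg X [| l t]; simpl.
  - split; [intros [] | now intros (l & _ & [])].
  - apply (Hg (fun v => In v l) X t).
Qed.

(** * Pairs, sums and recursion in the algebra *)

Definition pair (x y : realizer) : realizer := lam (fun z => app (app z x) y).
Definition fst (p : realizer) : realizer := app p (lam (fun x => lam (fun y => x))).
Definition snd (p : realizer) : realizer := app p (lam (fun x => lam (fun y => y))).
Definition inl (x : realizer) : realizer := lam (fun f => lam (fun g => app f x)).
Definition inr (x : realizer) : realizer := lam (fun f => lam (fun g => app g x)).
Definition case (e f g : realizer) : realizer := app (app e f) g.
Definition fixpt (f : realizer -> realizer) : realizer :=
  app (lam (fun x => f (app x x))) (lam (fun x => f (app x x))).

Lemma cont_fixpt g :
  (forall y, cont (fun x => g x y)) -> cont (fun x => fixpt (fun y => g x y)).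
Proof.
  intros Hg; apply cont_app; apply (cont_lam (fun x y => g x (app y y)));
    intros y; apply Hg.
Qed.

Ltac cont_basic :=
  intros; repeat first
    [ assumption
    | simple apply cont_const
    | simple apply cont_id
    | apply cont_app
    | apply cont_lam; intro ].

Lemma cont_pair f g :
  cont f -> cont g -> cont (fun x => pair (f x) (g x)).
Proof. unfold pair; cont_basic. Qed.

Lemma cont_fst f : cont f -> cont (fun x => fst (f x)).
Proof. unfold fst; cont_basic. Qed.

Lemma cont_snd f : cont f -> cont (fun x => snd (f x)).
Proof. unfold snd; cont_basic. Qed.

Lemma cont_inl f : cont f -> cont (fun x => inl (f x)).
Proof. unfold inl; cont_basic. Qed.

Lemma cont_inr f : cont f -> cont (fun x => inr (f x)).
Proof. unfold inr; cont_basic. Qed.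

Lemma cont_case e f g :
  cont e -> cont f -> cont g -> cont (fun x => case (e x) (f x) (g x)).
Proof. unfold case; cont_basic. Qed.

Lemma fst_pair x y : fst (pair x y) = x.
Proof. unfold fst, pair; rewrite !beta by cont_basic; reflexivity. Qed.

Lemma snd_pair x y : snd (pair x y) = y.
Proof. unfold snd, pair; rewrite !beta by cont_basic; reflexivity. Qed.

Lemma case_inl x f g : case (inl x) f g = app f x.
Proof. unfold case, inl; rewrite !beta by cont_basic; reflexivity. Qed.

Lemma case_inr x f g : case (inr x) f g = app g x.
Proof. unfold case, inr; rewrite !beta by cont_basic; reflexivity. Qed.

Lemma fixpt_eq f : cont f -> fixpt f = f (fixpt f).
Proof.
  intros Hf; unfold fixpt at 1; rewrite beta; [reflexivity |].
  intros X t.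
  (* With [app (lam f)] in place of [f], the body is built from applications, whose continuity is
     known. *)
  assert (H : cont (fun x => app (lam f) (app x x))) by cont_basic.
  replace f with (fun x => app (lam f) x).
  - apply H.
  - apply functional_extensionality; intros x; now apply beta.
Qed.

#[global] Opaque app lam pair fst snd inl inr case fixpt.

Ltac contin :=
  intros; repeat first
    [ assumption
    | simple apply cont_const
    | simple apply cont_id
    | apply cont_pair | apply cont_fst | apply cont_snd
    | apply cont_inl | apply cont_inr | apply cont_case
    | apply cont_app
    | apply cont_lam; intro
    | apply cont_fixpt; intro ].

Ltac reduce :=
  repeat first
    [ rewrite fst_pair | rewrite snd_pair | rewrite case_inl | rewrite case_inr
    | rewrite beta by contin ].

Definition top : realizer := fun _ => True.
Definition bot : realizer := fun _ => False.

Lemma inl_inj x y : inl x = inl y -> x = y.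
Proof.
  intros H; apply (f_equal (fun e => case e (lam (fun x => x)) bot)) in H.
  revert H; reduce; auto.
Qed.

Lemma inr_inj x y : inr x = inr y -> x = y.
Proof.
  intros H; apply (f_equal (fun e => case e bot (lam (fun x => x)))) in H.
  revert H; reduce; auto.
Qed.

(** Otherwise a [case] distinction would identify [top] with [bot], but only [top] contains
    [Atom]. *)
Lemma inl_neq_inr x y : inl x <> inr y.
Proof.
  intros H.
  apply (f_equal (fun e => case e (lam (fun _ => top)) (lam (fun _ => bot)))) in H.
  revert H; reduce; intros H; change (bot Atom); now rewrite <- H.
Qed.

(** * Names of sets and the realizability relation *)

(** In the usual realizability structures one realizer may index several elements of a set. Here an
    index determines its element, so that a realizer of a uniform existence statement points to one
    witness. *)
Inductive V : Type := sup (A : realizer -> Prop) (f : forall n, A n -> V).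

Definition entry (a : V) (n : realizer) (v : V) : Prop :=
  match a with sup A f => exists h : A n, f n h = v end.

(** [f] may formally depend on the proof that [n] is an index; proof irrelevance removes this. *)
Lemma entry_fun a n v w : entry a n v -> entry a n w -> v = w.
Proof.
  destruct a as [A f]; intros [h <-] [h' <-]; f_equal; apply proof_irrelevance.
Qed.

Lemma V_entry_ind (P : V -> Prop) :
  (forall a, (forall n v, entry a n v -> P v) -> P a) -> forall a, P a.
Proof.
  intros H a; induction a as [A f IH]; apply H; intros n v [h <-]; apply IH.
Qed.

(** Choice turns a relation into the family that [sup] expects. The result is faithful when [R] is
    functional in the index, as [entry_name] requires. *)
Definition name (R : realizer -> V -> Prop) : V :=
  sup (fun n => exists v, R n v)
      (fun n h => proj1_sig (constructive_indefinite_description _ h)).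

Lemma entry_name (R : realizer -> V -> Prop) :
  (forall n v w, R n v -> R n w -> v = w) ->
  forall n v, entry (name R) n v <-> R n v.
Proof.
  intros HR n v; simpl; split.
  - intros [h <-]; apply proj2_sig.
  - intros H; exists (ex_intro _ v H); apply (HR n); [apply proj2_sig | exact H].
Qed.

(** A two-way simulation: [fst e] sends an index of [a] to an index of [b] paired with a realizer
    that the two elements are equal, and [snd e] goes back. The clauses are spelled out to make the
    recursion structural in [a]; [eqv_unfold] gives the form used later. *)
Fixpoint eqv (a b : V) {struct a} : realizer -> Prop :=
  match a with
  | sup A f => fun e =>
      (forall n (h : A n), exists w,
          entry b (fst (app (fst e) n)) w /\
          eqv (f n h) w (snd (app (fst e) n))) /\
      (forall n w, entry b n w ->
         exists h : A (fst (app (snd e) n)),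
           eqv (f _ h) w (snd (app (snd e) n)))
  end.

Definition memv (a b : V) (e : realizer) : Prop :=
  exists v, entry b (fst e) v /\ eqv a v (snd e).

Lemma eqv_unfold a b e :
  eqv a b e <->
  (forall n v, entry a n v -> memv v b (app (fst e) n)) /\
  (forall n w, entry b n w ->
     exists v, entry a (fst (app (snd e) n)) v /\
               eqv v w (snd (app (snd e) n))).
Proof.
  destruct a as [A f]; simpl; split; intros [H1 H2]; split.
  - intros n v [h <-]; apply H1.
  - intros n w Hw; destruct (H2 n w Hw) as [h Hh]; eauto.
  - intros n h; apply (H1 n); eauto.
  - intros n w Hw; destruct (H2 n w Hw) as (v & [h <-] & Hv); eauto.
Qed.

(** Sends each index to itself and reuses itself for the elements, so it serves all names at
    once. *)
Definition rf : realizer :=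
  fixpt (fun r => pair (lam (fun n => pair n r)) (lam (fun n => pair n r))).

Lemma eqv_refl a : eqv a a rf.
Proof.
  induction a as [a IH] using V_entry_ind; apply eqv_unfold.
  unfold rf; rewrite fixpt_eq by contin; fold rf; reduce.
  split; intros n v Hv; reduce.
  - exists v; reduce; eauto.
  - exists v; eauto.
Qed.

Lemma memv_entry a n v : entry a n v -> memv v a (pair n rf).
Proof. intros H; exists v; reduce; split; [exact H | apply eqv_refl]. Qed.

Definition sm : realizer :=
  fixpt (fun s => lam (fun e =>
    pair (lam (fun n => pair (fst (app (snd e) n)) (app s (snd (app (snd e) n)))))
         (lam (fun n => pair (fst (app (fst e) n)) (app s (snd (app (fst e) n))))))).

Lemma eqv_sym a b e : eqv a b e -> eqv b a (app sm e).
Proof.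
  revert b e; induction a as [a IH] using V_entry_ind; intros b e.
  rewrite !eqv_unfold; intros [H1 H2].
  unfold sm; rewrite fixpt_eq by contin; fold sm; reduce.
  split; intros n v Hv; reduce.
  - destruct (H2 n v Hv) as (w & Hw & E); exists w; reduce; eauto.
  - destruct (H1 n v Hv) as (w & Hw & E); exists w; eauto.
Qed.

Definition tr : realizer :=
  fixpt (fun s => lam (fun e => lam (fun e' =>
    pair (lam (fun n =>
            pair (fst (app (fst e') (fst (app (fst e) n))))
                 (app (app s (snd (app (fst e) n)))
                      (snd (app (fst e') (fst (app (fst e) n)))))))
         (lam (fun n =>
            pair (fst (app (snd e) (fst (app (snd e') n))))
                 (app (app s (snd (app (snd e) (fst (app (snd e') n)))))
                      (snd (app (snd e') n)))))))).

Lemma eqv_trans a b c e e' :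
  eqv a b e -> eqv b c e' -> eqv a c (app (app tr e) e').
Proof.
  revert b c e e'; induction a as [a IH] using V_entry_ind; intros b c e e'.
  rewrite !eqv_unfold; intros [H1 H2] [H3 H4].
  unfold tr; rewrite fixpt_eq by contin; fold tr; reduce.
  split; intros n v Hv; reduce.
  - destruct (H1 n v Hv) as (w & Hw & E).
    destruct (H3 _ w Hw) as (u & Hu & E'); exists u; reduce; eauto.
  - destruct (H4 n v Hv) as (w & Hw & E).
    destruct (H2 _ w Hw) as (u & Hu & E'); exists u; eauto.
Qed.

#[global] Opaque rf sm tr.

Definition mem_l : realizer := lam (fun q => lam (fun e =>
  pair (fst e) (app (app tr (app sm q)) (snd e)))).
Definition mem_r : realizer := lam (fun q => lam (fun e =>
  pair (fst (app (fst q) (fst e)))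
       (app (app tr (snd e)) (snd (app (fst q) (fst e)))))).

Lemma memv_l a a' b q e : eqv a a' q -> memv a b e -> memv a' b (app (app mem_l q) e).
Proof.
  intros Hq (v & Hv & E); exists v; unfold mem_l; reduce; split; [exact Hv |].
  eauto using eqv_trans, eqv_sym.
Qed.

Lemma memv_r a b b' q e : eqv b b' q -> memv a b e -> memv a b' (app (app mem_r q) e).
Proof.
  intros [Hq _] %eqv_unfold (v & Hv & E).
  destruct (Hq _ _ Hv) as (w & Hw & E').
  exists w; unfold mem_r; reduce; eauto using eqv_trans.
Qed.

Definition ext : realizer := lam (fun e1 => lam (fun e2 =>
  pair (lam (fun n => app e1 (pair n rf)))
       (lam (fun n => pair (fst (app e2 (pair n rf)))
                           (app sm (snd (app e2 (pair n rf)))))))).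

Lemma eqv_ext a b e1 e2 :
  (forall z u, memv z a u -> memv z b (app e1 u)) ->
  (forall z u, memv z b u -> memv z a (app e2 u)) ->
  eqv a b (app (app ext e1) e2).
Proof.
  intros H1 H2; apply eqv_unfold; unfold ext; reduce.
  split; intros n v Hv; reduce.
  - apply H1, memv_entry, Hv.
  - destruct (H2 v (pair n rf)) as (w & Hw & E); [apply memv_entry, Hv |].
    eauto using eqv_sym.
Qed.

#[global] Opaque mem_l mem_r ext.

(** * Uniform realizability of formulas *)

Definition tval : Type := realizer -> Prop.
Definition oAnd (P Q : tval) : tval := fun e => P (fst e) /\ Q (snd e).
Definition oOr (P Q : tval) : tval := fun e =>
  (exists u, e = inl u /\ P u) \/ (exists u, e = inr u /\ Q u).
Definition oImp (P Q : tval) : tval := fun e => forall u, P u -> Q (app e u).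
(** [oAll] and [oEx] are uniform: the realizer carries no information about the
    set. *)
Definition oAll (F : V -> tval) : tval := fun e => forall v, F v e.
Definition oEx (F : V -> tval) : tval := fun e => exists v, F v e.

Definition scons (v : V) (rho : nat -> V) (n : nat) : V :=
  match n with 0 => v | S m => rho m end.

Fixpoint rlz (phi : form) (rho : nat -> V) : tval :=
  match phi with
  | Bot => fun _ => False
  | Eq x y => eqv (rho x) (rho y)
  | Mem x y => memv (rho x) (rho y)
  | And a b => oAnd (rlz a rho) (rlz b rho)
  | Or a b => oOr (rlz a rho) (rlz b rho)
  | Imp a b => oImp (rlz a rho) (rlz b rho)
  | All a => oAll (fun v => rlz a (scons v rho))
  | Ex a => oEx (fun v => rlz a (scons v rho))
  end.

Lemma and_intro P Q x y : P x -> Q y -> oAnd P Q (pair x y).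
Proof. intros; split; reduce; assumption. Qed.

Lemma or_inl P (Q : tval) x : P x -> oOr P Q (inl x).
Proof. left; eauto. Qed.

Lemma or_inr (P : tval) Q x : Q x -> oOr P Q (inr x).
Proof. right; eauto. Qed.

Lemma or_elim P Q R e f g :
  oOr P Q e -> oImp P R f -> oImp Q R g -> R (case e f g).
Proof.
  intros [(u & -> & H) | (u & -> & H)] Hf Hg; reduce; auto.
Qed.

Lemma imp_intro P Q c :
  cont c -> (forall u, P u -> Q (c u)) -> oImp P Q (lam c).
Proof. intros Hc H u Hu; rewrite beta by exact Hc; auto. Qed.

Lemma rlz_rename phi r rho :
  rlz (rename r phi) rho = rlz phi (fun n => rho (r n)).
Proof.
  revert r rho; induction phi; intros r rho; simpl;
    try (now rewrite ?IHphi1, ?IHphi2); f_equal;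
    apply functional_extensionality; intros v; rewrite IHphi; f_equal;
    apply functional_extensionality; intros [| n]; reflexivity.
Qed.

Lemma rlz_sub phi xs k rho :
  rlz (sub xs k phi) rho =
  rlz phi (fold_right (fun x => scons (rho x)) (fun n => rho (k + n)) xs).
Proof.
  unfold sub; rewrite rlz_rename; f_equal.
  induction xs as [| x xs IH]; [reflexivity |].
  simpl; rewrite <- IH; apply functional_extensionality; now intros [| n].
Qed.

Lemma rlz_shift phi v rho : rlz (shift phi) (scons v rho) = rlz phi rho.
Proof. apply rlz_sub. Qed.

Lemma rlz_inst phi t rho : rlz (sub [t] 0 phi) rho = rlz phi (scons (rho t) rho).
Proof. apply rlz_sub. Qed.

Lemma rlz_closure phi e :
  (forall rho, rlz phi rho e) -> forall rho, rlz (closure phi) rho e.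
Proof.
  unfold closure; induction (bound phi) as [| n IH]; intros H; [exact H |].
  intros rho v; now apply IH.
Qed.

Lemma var_subst (x i : nat) : exists c, forall rho rho' q,
  (forall j, j <> i -> rho j = rho' j) -> eqv (rho i) (rho' i) q ->
  eqv (rho x) (rho' x) (app c q).
Proof.
  destruct (Nat.eq_dec x i) as [-> | Hx].
  - exists (lam (fun q => q)); intros rho rho' q _ Hq; reduce; exact Hq.
  - exists (lam (fun q => rf)); intros rho rho' q H _; reduce.
    rewrite (H x Hx); apply eqv_refl.
Qed.

(** Leibniz's law. The realizer [s] depends on [phi] and [i] alone, so the same one passes under a
    uniform quantifier. An implication moves its premise backwards, along [sm q]. *)
Lemma rlz_subst phi : forall i, exists s, forall rho rho' q e,
  (forall j, j <> i -> rho j = rho' j) -> eqv (rho i) (rho' i) q ->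
  rlz phi rho e -> rlz phi rho' (app (app s q) e).
Proof.
  induction phi as [| x y | x y | a IHa b IHb | a IHa b IHb | a IHa b IHb
                   | a IHa | a IHa]; intros i.
  - exists bot; intros rho rho' q e _ _ [].
  - destruct (var_subst x i) as [c Hc]; destruct (var_subst y i) as [d Hd].
    exists (lam (fun q => lam (fun e =>
      app (app tr (app sm (app c q))) (app (app tr e) (app d q))))).
    intros rho rho' q e H Hq He; reduce; simpl in *.
    eauto 6 using eqv_trans, eqv_sym.
  - destruct (var_subst x i) as [c Hc]; destruct (var_subst y i) as [d Hd].
    exists (lam (fun q => lam (fun e =>
      app (app mem_l (app c q)) (app (app mem_r (app d q)) e)))).
    intros rho rho' q e H Hq He; reduce.
    apply (memv_l (rho x)); [now apply Hc |].
    apply (memv_r _ (rho y)); [now apply Hd | exact He].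
  - destruct (IHa i) as [s Hs]; destruct (IHb i) as [t Ht].
    exists (lam (fun q => lam (fun e =>
      pair (app (app s q) (fst e)) (app (app t q) (snd e))))).
    intros rho rho' q e H Hq [H1 H2]; reduce; simpl; apply and_intro; eauto.
  - destruct (IHa i) as [s Hs]; destruct (IHb i) as [t Ht].
    exists (lam (fun q => lam (fun e =>
      case e (lam (fun u => inl (app (app s q) u)))
             (lam (fun u => inr (app (app t q) u)))))).
    intros rho rho' q e H Hq [(u & -> & Hu) | (u & -> & Hu)]; reduce; simpl.
    + apply or_inl; eauto.
    + apply or_inr; eauto.
  - destruct (IHa i) as [s Hs]; destruct (IHb i) as [t Ht].
    exists (lam (fun q => lam (fun e => lam (fun u =>
      app (app t q) (app e (app (app s (app sm q)) u)))))).
    intros rho rho' q e H Hq He; reduce; simpl; apply imp_intro; [contin |].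
    intros u Hu; apply (Ht rho); auto; apply He; apply (Hs rho'); auto.
    + intros j Hj; symmetry; auto.
    + now apply eqv_sym.
  - destruct (IHa (S i)) as [s Hs]; exists s; intros rho rho' q e H Hq He v.
    apply (Hs (scons v rho)); auto.
    intros [| j] Hj; simpl; auto.
  - destruct (IHa (S i)) as [s Hs]; exists s; intros rho rho' q e H Hq [v He].
    exists v; apply (Hs (scons v rho)); auto.
    intros [| j] Hj; simpl; auto.
Qed.

Lemma rlz_subst0 phi : exists s, forall a b rho q e, eqv a b q ->
  rlz phi (scons a rho) e -> rlz phi (scons b rho) (app (app s q) e).
Proof.
  destruct (rlz_subst phi 0) as [s Hs]; exists s; intros a b rho q e Hq.
  apply Hs; [now intros [| j] | exact Hq].
Qed.

Lemma rlz_subst1 phi : exists s, forall x a b rho q e, eqv a b q ->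
  rlz phi (scons x (scons a rho)) e ->
  rlz phi (scons x (scons b rho)) (app (app s q) e).
Proof.
  destruct (rlz_subst phi 1) as [s Hs]; exists s; intros x a b rho q e Hq.
  apply Hs; [now intros [| [| j]] | exact Hq].
Qed.

(** * Soundness of natural deduction *)

Fixpoint ctx (G : list form) (rho : nat -> V) (c : realizer) : Prop :=
  match G with
  | [] => True
  | phi :: G' => rlz phi rho (fst c) /\ ctx G' rho (snd c)
  end.

Lemma ctx_shift G v rho c : ctx (map shift G) (scons v rho) c <-> ctx G rho c.
Proof.
  revert c; induction G as [| phi G IH]; intros c; simpl; [reflexivity |].
  now rewrite rlz_shift, IH.
Qed.

Lemma ctx_cons phi G rho x c :
  rlz phi rho x -> ctx G rho c -> ctx (phi :: G) rho (pair x c).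
Proof. intros; simpl; reduce; auto. Qed.

(** The realizer is fixed before the valuation [rho], as uniform quantifiers demand: generalization,
    instantiation and existential introduction leave it unchanged. *)
Lemma soundness G phi : prv G phi -> exists e, forall rho c,
  ctx G rho c -> rlz phi rho (app e c).
Proof.
  induction 1 as
    [G phi H | G phi _ [e He] | G phi psi _ [e He] _ [f Hf]
    | G phi psi _ [e He] | G phi psi _ [e He]
    | G phi psi _ [e He] | G phi psi _ [e He]
    | G phi psi chi _ [e He] _ [f Hf] _ [g Hg]
    | G phi psi _ [e He] | G phi psi _ [e He] _ [f Hf]
    | G phi _ [e He] | G phi t _ [e He] | G phi t _ [e He]
    | G phi chi _ [e He] _ [f Hf] | G x | G phi x y _ [e He] _ [f Hf]].
  - induction G as [| psi G IH]; [destruct H |].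
    destruct H as [-> | H].
    + exists (lam fst); intros rho c [Hc _].
      rewrite beta; [exact Hc | apply (cont_fst (fun x => x)), cont_id].
    + destruct (IH H) as [e He]; exists (lam (fun c => app e (snd c))).
      intros rho c [_ Hc]; reduce; auto.
  - exists e; intros rho c Hc; destruct (He rho c Hc).
  - exists (lam (fun c => pair (app e c) (app f c))); intros rho c Hc; reduce; simpl.
    apply and_intro; auto.
  - exists (lam (fun c => fst (app e c))); intros rho c Hc; reduce.
    now apply He.
  - exists (lam (fun c => snd (app e c))); intros rho c Hc; reduce.
    now apply He.
  - exists (lam (fun c => inl (app e c))); intros rho c Hc; reduce; simpl.
    apply or_inl; auto.
  - exists (lam (fun c => inr (app e c))); intros rho c Hc; reduce; simpl.
    apply or_inr; auto.
  - exists (lam (fun c => case (app e c) (lam (fun u => app f (pair u c)))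
                                         (lam (fun u => app g (pair u c))))).
    intros rho c Hc; reduce.
    apply (or_elim _ _ _ _ _ _ (He rho c Hc));
      (apply imp_intro; [contin |]); intros u Hu.
    + apply Hf, ctx_cons; assumption.
    + apply Hg, ctx_cons; assumption.
  - exists (lam (fun c => lam (fun u => app e (pair u c)))).
    intros rho c Hc; reduce; simpl; apply imp_intro; [contin |].
    intros u Hu; apply He, ctx_cons; assumption.
  - exists (lam (fun c => app (app e c) (app f c))); intros rho c Hc; reduce.
    exact (He rho c Hc _ (Hf rho c Hc)).
  - exists e; intros rho c Hc v; exact (He _ c (proj2 (ctx_shift G v rho c) Hc)).
  - exists e; intros rho c Hc; rewrite rlz_inst; exact (He rho c Hc (rho t)).
  - exists e; intros rho c Hc; exists (rho t); rewrite <- rlz_inst; auto.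
  - exists (lam (fun c => app f (pair (app e c) c))).
    intros rho c Hc; reduce; destruct (He rho c Hc) as [v Hv].
    rewrite <- (rlz_shift chi v rho); apply Hf, ctx_cons; [exact Hv |].
    now apply ctx_shift.
  - exists (lam (fun c => rf)); intros rho c Hc; reduce; apply eqv_refl.
  - destruct (rlz_subst0 phi) as [s Hs].
    exists (lam (fun c => app (app s (app e c)) (app f c))).
    intros rho c Hc; reduce; rewrite rlz_inst; eapply Hs; [apply He, Hc |].
    rewrite <- rlz_inst; auto.
Qed.

Definition realized (phi : form) : Prop := exists e, forall rho, rlz phi rho e.

(** The finitely many axioms of a proof are realized by one nested tuple, which is fed to the
    realizer from [soundness]. As nothing realizes [Bot], a theory with realized axioms is
    consistent. *)
Lemma realized_prv T phi :
  (forall psi, T psi -> realized psi) -> proves T phi -> realized phi.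
Proof.
  intros HT (G & HG & Hp); destruct (soundness _ _ Hp) as [e He].
  assert (exists c, forall rho, ctx G rho c) as [c Hc].
  { clear Hp He; induction G as [| psi G IH]; [now exists bot |].
    destruct IH as [c Hc]; [intros; apply HG; now right |].
    destruct (HT psi) as [x Hx]; [apply HG; now left |].
    exists (pair x c); intros rho; apply ctx_cons; auto. }
  exists (app e c); auto.
Qed.

(** * The axioms of CZF *)

Lemma realized_closure phi : realized phi -> realized (closure phi).
Proof. intros [e He]; exists e; now apply rlz_closure. Qed.

Lemma realized_extensionality : realized extensionality.
Proof.
  exists (lam (fun e => app (app ext (fst e)) (snd e))).
  intros rho a b; simpl; apply imp_intro; [contin |]; intros u Hu.
  apply eqv_ext; intros z w; apply (Hu z).
Qed.

(** The tags keep the indices of [a] and [b] apart, so each index names one element, and [case] on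
    the index decides the disjunction in the pairing axiom. *)
Definition vpair (a b : V) : V :=
  name (fun n v => (n = inl bot /\ v = a) \/ (n = inr bot /\ v = b)).

Lemma entry_pair a b n v :
  entry (vpair a b) n v <-> (n = inl bot /\ v = a) \/ (n = inr bot /\ v = b).
Proof.
  apply (entry_name (fun n v => (n = inl bot /\ v = a) \/ (n = inr bot /\ v = b))).
  intros m w w' [[-> ->] | [-> ->]] [[H ->] | [H ->]]; trivial;
    [| symmetry in H]; now apply inl_neq_inr in H.
Qed.

Definition pair_in : realizer :=
  lam (fun e => case e (lam (fun u => pair (inl bot) u))
                       (lam (fun u => pair (inr bot) u))).
Definition pair_out : realizer :=
  lam (fun e => case (fst e) (lam (fun _ => inl (snd e)))
                             (lam (fun _ => inr (snd e)))).

Lemma memv_pair_in z a b e :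
  oOr (eqv z a) (eqv z b) e -> memv z (vpair a b) (app pair_in e).
Proof.
  unfold pair_in; intros [(u & -> & Hu) | (u & -> & Hu)]; reduce.
  - exists a; reduce; split; [apply entry_pair; auto | exact Hu].
  - exists b; reduce; split; [apply entry_pair; auto | exact Hu].
Qed.

Lemma memv_pair_out z a b e :
  memv z (vpair a b) e -> oOr (eqv z a) (eqv z b) (app pair_out e).
Proof.
  unfold pair_out; intros (v & [[H ->] | [H ->]] %entry_pair & Hv); reduce;
    rewrite H; reduce; [apply or_inl | apply or_inr]; exact Hv.
Qed.

#[global] Opaque pair_in pair_out.

Lemma realized_pairing : realized pairing.
Proof.
  exists (pair pair_out pair_in); intros rho a b; exists (vpair a b); intros z.
  simpl; apply and_intro; intros u Hu;
    [apply memv_pair_out | apply memv_pair_in]; exact Hu.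
Qed.

Lemma realized_union : realized union.
Proof.
  exists (pair
    (lam (fun e => pair (pair (fst (fst e)) rf) (pair (snd (fst e)) (snd e))))
    (lam (fun e =>
      pair (pair (fst (fst e)) (fst (app (app mem_r (snd (fst e))) (snd e))))
           (snd (app (app mem_r (snd (fst e))) (snd e)))))).
  intros rho a.
  (* An index of the union pairs an index of [b] in [a] with an index in [b]; the first component
     determines [b], hence [R] is functional. *)
  set (R := fun p v => exists b, entry a (fst p) b /\ entry b (snd p) v).
  assert (HR : forall n v w, R n v -> R n w -> v = w).
  { intros n v w (b & H1 & H2) (b' & H3 & H4).
    rewrite (entry_fun _ _ _ _ H3 H1) in H4; exact (entry_fun _ _ _ _ H2 H4). }
  exists (name R); intros z; simpl; apply and_intro;
    (apply imp_intro; [contin |]).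
  - intros u (v & (b & Hb & Hv) %(entry_name R HR) & E).
    exists b; apply and_intro.
    + now apply memv_entry.
    + exists v; reduce; auto.
  - intros u (b & (b' & Hb' & E) & Hz); simpl in *.
    destruct (memv_r _ _ _ _ _ E Hz) as (v & Hv & E').
    exists v; reduce; split; [| exact E'].
    apply entry_name; [exact HR |]; exists b'; reduce; auto.
Qed.

(** The indices of the new set carry realizers of [phi], so [phi] need not be
    bounded. *)
Lemma realized_separation phi : realized (separation phi).
Proof.
  destruct (rlz_subst0 phi) as [s Hs].
  exists (pair
    (lam (fun e => pair (pair (fst (fst e)) (snd e))
                        (app (app s (app sm (snd e))) (snd (fst e)))))
    (lam (fun e => pair (pair (fst (fst e)) (app (app s (snd (fst e))) (snd e)))
                        (snd (fst e))))).
  intros rho a.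
  set (R := fun p v => entry a (fst p) v /\ rlz phi (scons v rho) (snd p)).
  assert (HR : forall n v w, R n v -> R n w -> v = w).
  { intros n v w [H1 _] [H2 _]; exact (entry_fun _ _ _ _ H1 H2). }
  exists (name R); intros z; simpl; rewrite rlz_sub; simpl; apply and_intro;
    (apply imp_intro; [contin |]).
  - intros u (v & [H1 H2] %(entry_name R HR) & E); apply and_intro.
    + exists v; reduce; auto.
    + apply (Hs v); [now apply eqv_sym | exact H2].
  - intros u [(v & H1 & E) H2].
    exists v; reduce; split; [| exact E].
    apply entry_name; [exact HR |]; split; reduce; [exact H1 |].
    now apply (Hs z).
Qed.

(** Choice outside the model picks one witness per index, so [b] can keep the index set of [a]. *)
Lemma choose_name (a : V) (P : realizer -> V -> V -> Prop) :
  (forall n v, entry a n v -> exists w, P n v w) ->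
  exists b, (forall n v, entry a n v -> exists w, entry b n w /\ P n v w) /\
            (forall n w, entry b n w -> exists v, entry a n v /\ P n v w).
Proof.
  destruct a as [A f]; intros H.
  pose (F n (h : A n) := constructive_indefinite_description _
    (H n (f n h) (ex_intro _ h eq_refl))).
  exists (sup A (fun n h => proj1_sig (F n h))); simpl; split.
  - intros n v [h <-]; eexists; split; [exists h; reflexivity |].
    apply proj2_sig.
  - intros n w [h <-]; eexists; split; [exists h; reflexivity |].
    apply proj2_sig.
Qed.

Lemma realized_strong_collection phi : realized (strong_collection phi).
Proof.
  destruct (rlz_subst0 phi) as [s Hs]; destruct (rlz_subst1 phi) as [t Ht].
  exists (lam (fun e => pair
    (lam (fun u => pair (pair (fst u) rf)
       (app (app s (app sm (snd u))) (app e (pair (fst u) rf)))))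
    (lam (fun u => pair (pair (fst u) rf)
       (app (app t (app sm (snd u))) (app e (pair (fst u) rf))))))).
  intros rho a; simpl; apply imp_intro; [contin |]; intros e He.
  (* [b] shares its indices with [a]: the index of [x] also serves for its partner [y], and
     conversely. *)
  destruct (choose_name a (fun n x y =>
    rlz phi (scons x (scons y rho)) (app e (pair n rf)))) as (b & H1 & H2).
  { intros n v Hv; destruct (He v _ (memv_entry _ _ _ Hv)) as [y Hy].
    rewrite rlz_sub in Hy; exists y; exact Hy. }
  exists b; apply and_intro; intros z; (apply imp_intro; [contin |]);
    intros u (v & Hv & E).
  - destruct (H1 _ _ Hv) as (y & Hy & Hphi); exists y; apply and_intro.
    + now apply memv_entry.
    + rewrite rlz_sub; apply (Hs v); [now apply eqv_sym | exact Hphi].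
  - destruct (H2 _ _ Hv) as (x & Hx & Hphi); exists x; apply and_intro.
    + now apply memv_entry.
    + rewrite rlz_sub; apply (Ht x v); [now apply eqv_sym | exact Hphi].
Qed.

Definition vfam (a b : V) (g : realizer) : V :=
  name (fun n w => (exists v, entry a n v) /\ entry b (app g n) w).

Lemma entry_fam a b g n w :
  entry (vfam a b g) n w <-> (exists v, entry a n v) /\ entry b (app g n) w.
Proof.
  apply (entry_name (fun n w => (exists v, entry a n v) /\ entry b (app g n) w)).
  intros m v v' [_ H] [_ H']; exact (entry_fun _ _ _ _ H H').
Qed.

Lemma realized_subset_collection phi : realized (subset_collection phi).
Proof.
  destruct (rlz_subst0 phi) as [s Hs]; destruct (rlz_subst1 phi) as [t Ht].
  exists (lam (fun e => pair
    (pair (lam (fun n => fst (fst (app e (pair n rf))))) rf)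
    (pair
      (lam (fun u => pair (pair (fst u) rf)
         (app (app s (app sm (snd u)))
            (app (app t (snd (fst (app e (pair (fst u) rf)))))
                 (snd (app e (pair (fst u) rf)))))))
      (lam (fun u => pair (pair (fst u) rf)
         (app (app t (app sm (snd u)))
            (app (app t (snd (fst (app e (pair (fst u) rf)))))
                 (snd (app e (pair (fst u) rf)))))))))).
  intros rho a b.
  (* The indices of the collecting set are the realizers [g] that map indices of [a] to indices of
     [b]. The set is thus fixed before the parameter [p]. *)
  set (R := fun g d =>
    (forall n v, entry a n v -> exists w, entry b (app g n) w) /\
    d = vfam a b g).
  assert (HR : forall n v w, R n v -> R n w -> v = w).
  { now intros n v v' [_ ->] [_ ->]. }
  exists (name R); intros p; simpl; apply imp_intro; [contin |]; intros e He.
  (* [e] contains an intensional choice function [g] on indices; [vfam a b g] is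
     its image. *)
  assert (H : forall n x, entry a n x -> exists y,
    entry b (fst (fst (app e (pair n rf)))) y /\
    rlz phi (scons x (scons y (scons p rho)))
      (app (app t (snd (fst (app e (pair n rf))))) (snd (app e (pair n rf))))).
  { intros n x Hx.
    destruct (He x _ (memv_entry _ _ _ Hx)) as (y & (y' & Hy' & E) & Hphi).
    exists y'; split; [exact Hy' |].
    rewrite rlz_sub in Hphi; exact (Ht x y y' _ _ _ E Hphi). }
  set (g := lam (fun n => fst (fst (app e (pair n rf))))).
  assert (Hg : forall n, app g n = fst (fst (app e (pair n rf)))).
  { intros n; unfold g; now reduce. }
  exists (vfam a b g); apply and_intro; [| apply and_intro]; try intros z.
  - apply memv_entry, entry_name; [exact HR |]; split; [| reflexivity].
    intros n v Hv; rewrite Hg; destruct (H n v Hv) as (y & Hy & _); eauto.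
  - apply imp_intro; [contin |]; intros u (x & Hx & E).
    destruct (H _ _ Hx) as (y & Hy & Hphi); exists y; apply and_intro.
    + apply memv_entry, entry_fam; rewrite Hg; eauto.
    + rewrite rlz_sub; apply (Hs x); [now apply eqv_sym | exact Hphi].
  - apply imp_intro; [contin |].
    intros u (y & [[x Hx] Hy] %entry_fam & E); rewrite Hg in Hy.
    destruct (H _ _ Hx) as (y' & Hy' & Hphi).
    rewrite (entry_fun _ _ _ _ Hy' Hy) in Hphi; exists x; apply and_intro.
    + now apply memv_entry.
    + rewrite rlz_sub; apply (Ht x y); [now apply eqv_sym | exact Hphi].
Qed.

(** The induction step is applied to its own fixed point. That this realizes [phi] at every name
    follows by induction on names, with [Hs] passing from a named element to any set equal to it. *)
Lemma realized_set_induction phi : realized (set_induction phi).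
Proof.
  destruct (rlz_subst0 phi) as [s Hs].
  exists (lam (fun e => fixpt (fun r =>
    app e (lam (fun u => app (app s (app sm (snd u))) r))))).
  intros rho; simpl; apply imp_intro; [contin |]; intros e He a.
  induction a as [a IH] using V_entry_ind.
  rewrite fixpt_eq by contin; apply (He a); intros z.
  apply imp_intro; [contin |]; intros u (v & Hv & E); rewrite rlz_sub.
  apply (Hs v); [now apply eqv_sym | eapply IH, Hv].
Qed.

(** * Natural numbers and infinity *)

Definition vempty : V := name (fun _ _ => False).

Lemma entry_empty n v : ~ entry vempty n v.
Proof. now intros [[w []] _]. Qed.

Definition vsucc (a : V) : V :=
  name (fun n v => (exists m, n = inl m /\ entry a m v) \/
                   (n = inr bot /\ v = a)).

Lemma entry_succ a n v :
  entry (vsucc a) n v <->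
  (exists m, n = inl m /\ entry a m v) \/ (n = inr bot /\ v = a).
Proof.
  apply (entry_name (fun n v => (exists m, n = inl m /\ entry a m v) \/
                                (n = inr bot /\ v = a))).
  intros k w w' [(m & -> & H) | [-> ->]] [(m' & E & H') | [E ->]]; trivial.
  - apply inl_inj in E as ->; exact (entry_fun _ _ _ _ H H').
  - now apply inl_neq_inr in E.
  - symmetry in E; now apply inl_neq_inr in E.
Qed.

Definition vnat (k : nat) : V := Nat.iter k vsucc vempty.
(** Unary numerals, the indices of [vomega]: [case] separates zero from successors, which permits
    recursion on an index. *)
Definition num (k : nat) : realizer := Nat.iter k inr (inl bot).

Lemma num_inj k l : num k = num l -> k = l.
Proof.
  revert l; induction k as [| k IH]; intros [| l]; simpl; intros H; trivial.
  - now apply inl_neq_inr in H.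
  - symmetry in H; now apply inl_neq_inr in H.
  - f_equal; now apply IH, inr_inj.
Qed.

Definition vomega : V := name (fun n v => exists k, n = num k /\ v = vnat k).

Lemma entry_omega n v :
  entry vomega n v <-> exists k, n = num k /\ v = vnat k.
Proof.
  apply (entry_name (fun n v => exists k, n = num k /\ v = vnat k)).
  intros m w w' (k & -> & ->) (l & H & ->); f_equal; now apply num_inj.
Qed.

Definition succ_code : realizer :=
  pair (lam (fun e => case (fst e) (lam (fun m => inl (pair m (snd e))))
                                   (lam (fun _ => inr (snd e)))))
       (lam (fun e => case e (lam (fun u => pair (inl (fst u)) (snd u)))
                             (lam (fun u => pair (inr bot) u)))).

Lemma rlz_succ a rho :
  rlz (is_succ 0 1) (scons (vsucc a) (scons a rho)) succ_code.
Proof.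
  intros z; simpl; apply and_intro; (apply imp_intro; [contin |]).
  - intros u (v & [(m & H & Hv) | [H ->]] %entry_succ & E); rewrite H; reduce.
    + apply or_inl; exists v; reduce; auto.
    + apply or_inr; exact E.
  - intros u [(w & -> & v & Hv & E) | (w & -> & E)]; reduce.
    + exists v; reduce; split; [apply entry_succ; eauto | exact E].
    + exists a; reduce; split; [apply entry_succ; eauto | exact E].
Qed.

#[global] Opaque succ_code.

Definition same : realizer := lam (fun e => lam (fun e' =>
  app (app ext (lam (fun u => app (snd e') (app (fst e) u))))
      (lam (fun u => app (snd e) (app (fst e') u))))).

(** Membership passes through the common defining condition [P]. This serves for successors and
    unordered pairs, which the formulas describe only by their elements. *)
Lemma eqv_same (P : V -> tval) a b e e' :
  (forall z, oAnd (oImp (memv z a) (P z)) (oImp (P z) (memv z a)) e) ->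
  (forall z, oAnd (oImp (memv z b) (P z)) (oImp (P z) (memv z b)) e') ->
  eqv a b (app (app same e) e').
Proof.
  intros H H'; unfold same; reduce; apply eqv_ext; intros z u Hu; reduce.
  - exact (proj2 (H' z) _ (proj1 (H z) _ Hu)).
  - exact (proj2 (H z) _ (proj1 (H' z) _ Hu)).
Qed.

#[global] Opaque same.

(** Minimality is recursion along the index: the fixed point sends [num k] to a realizer that
    [vnat k] belongs to the inductive set [b]. *)
Lemma realized_strong_infinity : realized strong_infinity.
Proof.
  destruct (rlz_subst1 (is_succ 0 1)) as [s Hs].
  exists (pair
    (pair (pair (pair (inl bot) rf) bot)
          (lam (fun u => pair (pair (inr (fst u)) rf)
                              (app (app s (app sm (snd u))) succ_code))))
    (lam (fun i => lam (fun u => app (app mem_l (app sm (snd u)))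
       (app (fixpt (fun r => lam (fun n => case n
          (lam (fun _ => app (app mem_l rf) (fst (fst i))))
          (lam (fun m => app (app mem_l
              (app (app same (snd (app (snd i) (app r m)))) succ_code))
            (fst (app (snd i) (app r m)))))))) (fst u)))))).
  intros rho; exists vomega; simpl; apply and_intro; [apply and_intro |].
  - exists vempty; apply and_intro.
    + apply memv_entry, entry_omega; exists 0; auto.
    + intros z u (v & Hv & _); now apply entry_empty in Hv.
  - intros z; apply imp_intro; [contin |]; intros u (v & Hv & E).
    apply entry_omega in Hv as (k & -> & ->).
    exists (vsucc (vnat k)); apply and_intro.
    + apply memv_entry, entry_omega; exists (S k); auto.
    + apply (Hs _ (vnat k) z (scons vomega rho));
        [now apply eqv_sym | exact (rlz_succ _ _)].
  - intros b; apply imp_intro; [contin |]; intros i Hi z.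
    apply imp_intro; [contin |]; intros u (v & Hv & E).
    apply entry_omega in Hv as (k & -> & ->).
    apply (memv_l (vnat k)); [now apply eqv_sym |]; clear E z u.
    destruct Hi as [(z & Hz & Hz0) Hi].
    induction k as [| k IH]; rewrite fixpt_eq by contin; reduce; simpl; reduce.
    + apply (memv_l z); [| exact Hz].
      (* Neither side has an entry, so any realizer, here [rf], realizes the equality. *)
      apply eqv_unfold; split; intros n v Hv.
      * destruct (Hz0 v _ (memv_entry _ _ _ Hv)).
      * now apply entry_empty in Hv.
    + destruct (Hi _ _ IH) as (t & Ht & Hsucc).
      apply (memv_l t); [| exact Ht].
      exact (eqv_same _ _ _ _ _ Hsucc (rlz_succ (vnat k) (fun _ => b))).
Qed.

Lemma realized_CZF phi : CZF phi -> realized phi.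
Proof.
  intros [| | | psi _ | | psi | psi | psi]; try apply realized_closure.
  - exact realized_extensionality.
  - exact realized_pairing.
  - exact realized_union.
  - apply realized_separation.
  - exact realized_strong_infinity.
  - apply realized_strong_collection.
  - apply realized_subset_collection.
  - apply realized_set_induction.
Qed.

(** * Ordered pairs *)

Definition env3 (a b c : V) : nat -> V :=
  scons a (scons b (scons c (fun _ => vempty))).

Lemma rlz_subst3 phi : exists s, forall a b c a' b' c' q0 q1 q2 e,
  eqv a a' q0 -> eqv b b' q1 -> eqv c c' q2 ->
  rlz phi (env3 a b c) e ->
  rlz phi (env3 a' b' c') (app (app (app (app s q0) q1) q2) e).
Proof.
  destruct (rlz_subst phi 0) as [s0 H0]; destruct (rlz_subst phi 1) as [s1 H1].
  destruct (rlz_subst phi 2) as [s2 H2].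
  exists (lam (fun q0 => lam (fun q1 => lam (fun q2 => lam (fun e =>
    app (app s2 q2) (app (app s1 q1) (app (app s0 q0) e))))))).
  intros; reduce.
  apply (H2 (env3 a' b' c)); [now intros [| [| [| j]]] | assumption |].
  apply (H1 (env3 a' b c)); [now intros [| [| [| j]]] | assumption |].
  apply (H0 (env3 a b c)); [now intros [| [| [| j]]] | assumption | assumption].
Qed.

(** These truth values, and those for maps and injectivity below, agree by conversion with [rlz] of
    the corresponding formulas and avoid de Bruijn indices. *)
Definition oIff (P Q : tval) : tval := oAnd (oImp P Q) (oImp Q P).

Definition oUpair (z a b : V) : tval :=
  oAll (fun x => oIff (memv x z) (oOr (eqv x a) (eqv x b))).

Definition oOpair (p x y : V) : tval :=
  oEx (fun s => oEx (fun d =>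
    oAnd (oUpair s x x) (oAnd (oUpair d x y) (oUpair p s d)))).

Definition vopair (x y : V) : V := vpair (vpair x x) (vpair x y).

Lemma upair_intro a b : oUpair (vpair a b) a b (pair pair_out pair_in).
Proof.
  intros z; apply and_intro; intros u Hu;
    [apply memv_pair_out | apply memv_pair_in]; exact Hu.
Qed.

Lemma upair_elim z a b e : oUpair z a b e ->
  eqv z (vpair a b) (app (app same e) (pair pair_out pair_in)).
Proof. intros H; eapply eqv_same; [exact H | apply upair_intro]. Qed.

Definition opair_in : realizer :=
  pair (pair pair_out pair_in)
       (pair (pair pair_out pair_in) (pair pair_out pair_in)).

Lemma opair_intro x y : oOpair (vopair x y) x y opair_in.
Proof.
  exists (vpair x x), (vpair x y).
  apply and_intro; [| apply and_intro]; apply upair_intro.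
Qed.

(** The witnesses for the two components equal canonical pairs; once these are substituted, [p] has
    the same elements as [vopair x y]. *)
Lemma opair_elim : exists c, forall p x y e,
  oOpair p x y e -> eqv p (vopair x y) (app c e).
Proof.
  destruct (rlz_subst3 (is_upair 0 1 2)) as [s Hs].
  pose (u := pair pair_out pair_in).
  exists (lam (fun e => app (app same (app (app (app (app s rf)
    (app (app same (fst e)) u)) (app (app same (fst (snd e))) u))
    (snd (snd e)))) u)).
  intros p x y e (a & b & H1 & H2 & H3); reduce.
  apply upair_elim.
  apply (Hs p a b);
    [apply eqv_refl | now apply upair_elim | now apply upair_elim | exact H3].
Qed.

Definition collapse : realizer :=
  lam (fun e => case e (lam (fun x => x)) (lam (fun x => x))).

Lemma or_same (P : tval) e : oOr P P e -> P (app collapse e).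
Proof. unfold collapse; intros [(u & -> & H) | (u & -> & H)]; now reduce. Qed.

Definition in_l : realizer := lam (fun q =>
  app pair_out (app (app mem_r q) (app pair_in (inl rf)))).
Definition in_r : realizer := lam (fun q =>
  app pair_out (app (app mem_r q) (app pair_in (inr rf)))).

Lemma pair_l a b c d q :
  eqv (vpair a b) (vpair c d) q -> oOr (eqv a c) (eqv a d) (app in_l q).
Proof.
  intros Hq; unfold in_l; reduce.
  eapply memv_pair_out, memv_r; [exact Hq |].
  apply memv_pair_in, or_inl, eqv_refl.
Qed.

Lemma pair_r a b c d q :
  eqv (vpair a b) (vpair c d) q -> oOr (eqv b c) (eqv b d) (app in_r q).
Proof.
  intros Hq; unfold in_r; reduce.
  eapply memv_pair_out, memv_r; [exact Hq |].
  apply memv_pair_in, or_inr, eqv_refl.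
Qed.

#[global] Opaque opair_in collapse in_l in_r.

(** [vpair x x] equals one of the two components of the second pair, and [x'] lies in both of them;
    so [x'] lies in [vpair x x]. *)
Lemma opair_fst : exists c, forall x y x' y' e,
  eqv (vopair x y) (vopair x' y') e -> eqv x' x (app c e).
Proof.
  exists (lam (fun e => case (app in_l e)
    (lam (fun r => app collapse (app in_l (app sm r))))
    (lam (fun r => app collapse (app in_l (app sm r)))))).
  intros x y x' y' e H; reduce.
  apply (or_elim _ _ _ _ _ _ (pair_l _ _ _ _ _ H));
    (apply imp_intro; [contin |]); intros u Hu;
    eapply or_same, pair_l, eqv_sym, Hu.
Qed.

Lemma opair_snd_cases : exists c, forall x y x' y' e,
  eqv (vopair x y) (vopair x' y') e -> oOr (eqv y' x) (eqv y' y) (app c e).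
Proof.
  exists (lam (fun e => case (app in_r (app sm e))
    (lam (fun r => inl (app collapse (app in_r r))))
    (lam (fun r => app in_r r)))).
  intros x y x' y' e H; reduce.
  apply (or_elim _ _ _ _ _ _ (pair_r _ _ _ _ _ (eqv_sym _ _ _ H)));
    (apply imp_intro; [contin |]); intros u Hu.
  - eapply or_inl, or_same, pair_r, Hu.
  - eapply pair_r, Hu.
Qed.

(** If [y'] equals [x] and [y] equals [x'], then [opair_fst] closes the chain from [y] over [x'] and
    [x] to [y']. Every other case gives the equality at once. *)
Lemma vopair_snd : exists c, forall x y x' y' e,
  eqv (vopair x y) (vopair x' y') e -> eqv y y' (app c e).
Proof.
  destruct opair_fst as [c Hc]; destruct opair_snd_cases as [d Hd].
  exists (lam (fun e => case (app d e)
    (lam (fun k => case (app d (app sm e))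
       (lam (fun l => app (app tr (app (app tr l) (app c e))) (app sm k)))
       (lam (fun l => l))))
    (lam (fun k => app sm k)))).
  intros x y x' y' e H; reduce.
  apply (or_elim _ _ _ _ _ _ (Hd _ _ _ _ _ H));
    (apply imp_intro; [contin |]); intros k Hk; [| now apply eqv_sym].
  apply (or_elim _ _ _ _ _ _ (Hd _ _ _ _ _ (eqv_sym _ _ _ H)));
    (apply imp_intro; [contin |]); intros l Hl; [| exact Hl].
  eapply eqv_trans; [| eapply eqv_sym, Hk].
  eapply eqv_trans; [exact Hl | eapply Hc, H].
Qed.

Lemma opair_snd : exists c, forall p x y x' y' e e',
  oOpair p x y e -> oOpair p x' y' e' -> eqv y y' (app (app c e) e').
Proof.
  destruct vopair_snd as [c Hc]; destruct opair_elim as [d Hd].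
  exists (lam (fun e => lam (fun e' =>
    app c (app (app tr (app sm (app d e))) (app d e'))))).
  intros p x y x' y' e e' H H'; reduce; eapply Hc, eqv_trans.
  - eapply eqv_sym, Hd, H.
  - eapply Hd, H'.
Qed.

Lemma image_name (a : V) (F : V -> V) : exists b,
  (forall n v, entry a n v -> entry b n (F v)) /\
  (forall n w, entry b n w -> exists v, entry a n v /\ w = F v).
Proof.
  destruct (choose_name a (fun _ v w => w = F v)) as (b & H1 & H2); [eauto |].
  exists b; split; [| exact H2].
  intros n v Hv; destruct (H1 n v Hv) as (w & Hw & ->); exact Hw.
Qed.

(** * Injective sets *)

Definition oMaps (f x y : V) : tval :=
  oEx (fun p => oAnd (memv p f) (oOpair p x y)).

Definition oMap (f X Y : V) : tval :=
  oAnd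
    (oAll (fun p => oImp (memv p f)
       (oEx (fun x => oAnd (memv x X)
          (oEx (fun y => oAnd (memv y Y) (oOpair p x y)))))))
    (oAll (fun x => oImp (memv x X)
       (oEx (fun y => oAnd (oMaps f x y)
          (oAll (fun z => oImp (oMaps f x z) (eqv z y))))))).

Definition oRestr (f g X : V) : tval :=
  oAll (fun p => oIff (memv p f)
    (oAnd (memv p g)
       (oEx (fun x => oAnd (memv x X) (oEx (fun y => oOpair p x y)))))).

Definition oInj (E : V) : tval :=
  oAll (fun X => oAll (fun Y => oAll (fun f =>
    oImp (oAnd (oAll (fun z => oImp (memv z X) (memv z Y))) (oMap f X E))
         (oEx (fun g => oAnd (oMap g Y E) (oRestr f g X)))))).

Definition oSing (E : V) : tval :=
  oEx (fun s => oAll (fun z => oIff (memv z E) (eqv z s))).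

Lemma opair_subst : exists s, forall p x y p' x' y' q0 q1 q2 e,
  eqv p p' q0 -> eqv x x' q1 -> eqv y y' q2 ->
  oOpair p x y e ->
  oOpair p' x' y' (app (app (app (app s q0) q1) q2) e).
Proof. exact (rlz_subst3 (is_opair 0 1 2)). Qed.

Lemma sing_injective : exists c, forall E w, oSing E w -> oInj E (app c w).
Proof.
  destruct opair_subst as [os Hos]; destruct opair_snd as [oj Hoj].
  destruct opair_elim as [oe Hoe].
  (* [sb] moves an ordered pair along three equalities. [T] decomposes a member of [f], [M] finds
     the member of [f] over a given point of [X], and [T'] decomposes that member. *)
  pose (sb := fun q0 q1 q2 e => app (app (app (app os q0) q1) q2) e).
  pose (T := fun a u => app (fst (snd a)) u).
  pose (M := fun a u => fst (app (snd (snd a)) (fst (snd u)))).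
  pose (T' := fun a u => T a (fst (M a u))).
  exists (lam (fun w => lam (fun a => pair
    (pair
      (lam (fun u => pair (pair (fst u) rf)
         (pair (app (snd w) rf) (sb (app sm (snd u)) rf rf opair_in))))
      (lam (fun u => pair
         (pair (pair (fst u) rf) (sb rf (app sm (snd u)) rf opair_in))
         (lam (fun k => app (app oj (snd k))
            (sb (app sm (snd (fst k))) rf rf opair_in))))))
    (pair
      (lam (fun u => pair
         (pair (fst (app (fst a) (fst (T a u))))
            (app oe (sb rf (snd (app (fst a) (fst (T a u))))
               (app (fst w) (fst (snd (T a u)))) (snd (snd (T a u))))))
         (pair (fst (T a u)) (snd (snd (T a u))))))
      (lam (fun u => app (app mem_l
         (app (app tr
           (app oe (sb rf rf (app (app tr (app (app oj (snd (M a u)))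
                                               (snd (snd (T' a u)))))
                                  (app (fst w) (fst (snd (T' a u)))))
                       (snd (M a u)))))
           (app sm (app oe (sb rf rf
             (app (app oj (snd (snd u)))
                  (sb (app sm (snd (fst u))) rf rf opair_in))
             (snd (snd u)))))))
         (fst (M a u)))))))).
  subst sb T' T M; cbv beta.
  intros E w [s Hs]; reduce; intros X Y f.
  apply imp_intro; [contin |]; intros a [Hsub [Hf1 Hf2]].
  destruct (image_name Y (fun v => vopair v s)) as (g & Hg1 & Hg2).
  exists g; apply and_intro; [apply and_intro | intros p; apply and_intro].
  - intros p; apply imp_intro; [contin |]; intros u (v & Hv & E1).
    apply Hg2 in Hv as (v' & Hv' & ->).
    exists v'; apply and_intro; [now apply memv_entry |].
    exists s; apply and_intro; [apply (Hs s), eqv_refl |].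
    eapply Hos; [eapply eqv_sym, E1 | apply eqv_refl | apply eqv_refl |
                 apply opair_intro].
  - intros z; apply imp_intro; [contin |]; intros u (v & Hv & E1).
    exists s; apply and_intro.
    + exists (vopair v s); apply and_intro; [now apply memv_entry, Hg1 |].
      eapply Hos; [apply eqv_refl | eapply eqv_sym, E1 | apply eqv_refl |
                   apply opair_intro].
    + intros y; apply imp_intro; [contin |]; intros k (p & (t & Ht & E2) & Hk).
      apply Hg2 in Ht as (v' & Hv' & ->).
      eapply Hoj; [exact Hk |].
      eapply Hos; [eapply eqv_sym, E2 | apply eqv_refl | apply eqv_refl |
                   apply opair_intro].
  - apply imp_intro; [contin |]; intros u Hu.
    destruct (Hf1 p u Hu) as (x & Hx & y & Hy & Ho).
    destruct (Hsub x _ Hx) as (v & Hv & E1).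
    apply and_intro.
    + exists (vopair v s); reduce; split; [now apply Hg1 |].
      eapply Hoe, Hos; [apply eqv_refl | exact E1 | | exact Ho].
      now apply (Hs y).
    + exists x; apply and_intro; [exact Hx |]; exists y; exact Ho.
  - apply imp_intro; [contin |]; intros u [(t & Ht & E1) (x & Hx & y & Ho)].
    apply Hg2 in Ht as (v & Hv & ->).
    destruct (Hf2 x _ Hx) as (y1 & (p1 & Hp1 & Ho1) & _).
    destruct (Hf1 p1 _ Hp1) as (x' & _ & y' & Hy' & Ho').
    apply (memv_l p1); [| exact Hp1].
    (* Both [p1] and [p] are the pair of [x] and [s]: [p1] because its value lies in [E], and [p]
       because it belongs to the constant map [g]. *)
    apply (eqv_trans _ (vopair x s)); [| apply eqv_sym]; eapply Hoe, Hos;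
      try apply eqv_refl.
    + eapply eqv_trans; [eapply Hoj; [exact Ho1 | exact Ho'] |].
      now apply (Hs y').
    + exact Ho1.
    + eapply Hoj; [exact Ho |].
      eapply Hos; [eapply eqv_sym, E1 | apply eqv_refl | apply eqv_refl |
                   apply opair_intro].
    + exact Ho.
Qed.

Lemma injective_sing : exists c, forall E w, oInj E w -> oSing E (app c w).
Proof.
  destruct opair_subst as [os Hos]; destruct opair_snd as [oj Hoj].
  pose (sb := fun q0 q1 q2 e => app (app (app (app os q0) q1) q2) e).
  (* [h] realizes, for every [x], that [X] is a subset of [{x}] and that the
     inclusion of [X] in [E] is a map. *)
  pose (h := pair
    (lam (fun u => pair (inl bot) (app (app tr (snd u)) (snd (fst u)))))
    (pair
      (lam (fun u => pair (pair (fst u) rf)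
         (pair (pair (fst (fst u)) rf) (sb (app sm (snd u)) rf rf opair_in))))
      (lam (fun u => pair
         (pair (pair (fst u) rf) (sb rf (app sm (snd u)) rf opair_in))
         (lam (fun k => app (app tr
             (app (app oj (snd k)) (sb (app sm (snd (fst k))) rf rf opair_in)))
           (app (app tr (snd (fst (fst k)))) (app sm (snd (fst u)))))))))).
  (* For [r] realizing that [g] is a map on [{x}] extending the inclusion, [B r] gives the value of
     [g] at [x], and [C r] decomposes the corresponding member of [g]. The index of the value in [E]
     is [fst (fst (snd (C r)))]. *)
  pose (B := fun r => app (snd (fst r)) (pair (inl bot) rf)).
  pose (C := fun r => app (fst (fst r)) (fst (fst (B r)))).
  exists (lam (fun w => pair
    (lam (fun u => app (app tr (snd u)) (app (app tr
       (app (snd (B (app w h)))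
          (pair (fst (app (fst (snd (app w h)))
                          (pair (pair (fst u) (app sm (snd u))) rf)))
                (sb rf (app sm (snd u)) rf opair_in))))
       (app (app tr (app sm (app (snd (B (app w h)))
          (pair (fst (fst (B (app w h))))
             (sb rf (app collapse (app pair_out (fst (C (app w h))))) rf
                 (snd (snd (C (app w h)))))))))
          (snd (fst (snd (C (app w h)))))))))
    (lam (fun q => pair (fst (fst (snd (C (app w h))))) q)))).
  intros E w Hw.
  (* An index of [X] pairs an index in [E] with a realizer of the equality with [x], as in
     separation. *)
  assert (HR : forall x n v v', entry E (fst n) v /\ eqv v x (snd n) ->
                                entry E (fst n) v' /\ eqv v' x (snd n) -> v = v').
  { intros x n v v' [H _] [H' _]; exact (entry_fun _ _ _ _ H H'). }
  assert (key : forall x, exists f g,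
    (forall n v, entry E (fst n) v -> eqv v x (snd n) ->
                 entry f n (vopair v v)) /\
    oAnd (oMap g (vpair x x) E)
         (oRestr f g (name (fun n v => entry E (fst n) v /\ eqv v x (snd n))))
         (app w h)).
  { intros x; set (X := name _).
    pose proof (entry_name _ (HR x)) as HX; fold X in HX.
    destruct (image_name X (fun v => vopair v v)) as (f & Hf1 & Hf2).
    assert (H : oAnd (oAll (fun z => oImp (memv z X) (memv z (vpair x x))))
                     (oMap f X E) h).
    { unfold h; subst sb; cbv beta.
      apply and_intro; [| apply and_intro]; intros z;
        (apply imp_intro; [contin |]); intros u (v & Hv & E1).
      - apply HX in Hv as [_ Hv]; exists x; reduce.
        split; [apply entry_pair; auto | now apply (eqv_trans _ v)].
      - apply Hf2 in Hv as (v' & Hv & ->).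
        exists v'; apply and_intro; [now apply memv_entry |].
        exists v'; apply and_intro; [now apply memv_entry; apply HX in Hv |].
        eapply Hos; [eapply eqv_sym, E1 | apply eqv_refl | apply eqv_refl |
                     apply opair_intro].
      - exists v; apply and_intro.
        + exists (vopair v v); apply and_intro; [now apply memv_entry, Hf1 |].
          eapply Hos; [apply eqv_refl | eapply eqv_sym, E1 | apply eqv_refl |
                       apply opair_intro].
        + intros y; apply imp_intro; [contin |].
          intros k (p & (t & Ht & E2) & Hk).
          apply Hf2 in Ht as (v' & Hv' & ->).
          apply HX in Hv as [_ Hv]; apply HX in Hv' as [_ Hv'].
          apply (eqv_trans _ v').
          * eapply Hoj; [exact Hk |].
            eapply Hos; [eapply eqv_sym, E2 | apply eqv_refl | apply eqv_refl |
                         apply opair_intro].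
          * apply (eqv_trans _ x); [exact Hv' | now apply eqv_sym]. }
    destruct (Hw X (vpair x x) f _ H) as [g Hg].
    exists f, g; split; [| exact Hg].
    intros n v H1 H2; apply Hf1, HX; auto. }
  assert (val : forall x, memv x (vpair x x) (pair (inl bot) rf)).
  { intros x; apply memv_entry, entry_pair; auto. }
  (* The index of the value of [g] is computed from [w] alone, hence is the same
     for all [x]; its name [s] can be read off at [x = vempty]. *)
  assert (exists s, entry E (fst (fst (snd (C (app w h))))) s) as [s Hs].
  { destruct (key vempty) as (f & g & _ & [Hg1 Hg2] & _).
    destruct (Hg2 _ _ (val vempty)) as (y0 & (p & Hp & _) & _).
    destruct (Hg1 _ _ Hp) as (x' & _ & y' & (s & Hs & _) & _).
    exists s; exact Hs. }
  reduce; exists s; intros z; apply and_intro; subst B C sb; cbv beta in *;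
    (apply imp_intro; [contin |]).
  - intros u (v & Hv & E1).
    destruct (key z) as (f & g & Hf & [Hg1 Hg2] & Hr).
    destruct (Hg2 _ _ (val z)) as (y0 & (p & Hp & Hpo) & Huniq).
    destruct (Hg1 _ _ Hp) as (x' & Hx' & y' & (s' & Hs' & E2) & Ho).
    (* Uniformity enters here: [s'], obtained at [z], and [s], obtained at [vempty], have the same
       index in [E] and hence coincide. *)
    rewrite (entry_fun _ _ _ _ Hs' Hs) in E2.
    apply (eqv_trans _ v); [exact E1 |].
    apply (eqv_trans _ y0); [| apply (eqv_trans _ y'); [apply eqv_sym | exact E2]].
    (* [v] is a value of [g] at [z], since the pair of [v] with itself lies in the restriction [f];
       so is [y']. Both therefore equal [y0]. *)
    + apply (Huniq v); exists (vopair v v); apply and_intro.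
      * apply (Hr (vopair v v)), memv_entry, Hf; reduce; [exact Hv |].
        now apply eqv_sym.
      * eapply Hos; [apply eqv_refl | eapply eqv_sym, E1 | apply eqv_refl |
                     apply opair_intro].
    + apply (Huniq y'); exists p; apply and_intro; [exact Hp |].
      eapply Hos; [apply eqv_refl | | apply eqv_refl | exact Ho].
      now apply or_same, memv_pair_out.
  - intros q Hq; exists s; reduce; auto.
Qed.

Lemma realized_injective_iff_singleton : realized injective_iff_singleton.
Proof.
  destruct injective_sing as [c Hc]; destruct sing_injective as [d Hd].
  exists (pair (lam (fun w => app c w)) (lam (fun w => app d w))).
  intros rho E; apply and_intro; apply imp_intro;
    [contin | exact (Hc E) | contin | exact (Hd E)].
Qed.

(** [A] consists of the empty set and its singleton. An embedding of [A] into a singleton sends both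
    to [s], so injectivity equates them, although the singleton has an entry and [vempty] has
    none. *)
Lemma enough_injectives_unrealized : ~ realized enough_injectives.
Proof.
  intros [e He].
  destruct injective_sing as [c Hc]; destruct opair_snd as [oj Hoj].
  set (A := vpair vempty (vpair vempty vempty)).
  destruct (He (fun _ => vempty) A) as (E & HE & j & [Hj1 Hj2] & Hinj).
  destruct (Hc E _ HE) as [s Hs].
  assert (val : forall x u, memv x A u -> exists q,
    oMaps j x s q).
  { intros x u Hx.
    destruct (Hj2 x _ Hx) as (y & (p & Hp & Ho) & _).
    destruct (Hj1 p _ Hp) as (x' & _ & y' & Hy' & Ho').
    destruct opair_subst as [os Hos].
    eexists; exists p; apply and_intro; [exact Hp |].
    eapply Hos; [apply eqv_refl | apply eqv_refl | | exact Ho].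
    exact (eqv_trans _ _ _ _ _ (Hoj _ _ _ _ _ _ _ Ho Ho')
             (proj1 (Hs y') _ Hy')). }
  destruct (val vempty (pair (inl bot) rf)) as [q0 H0].
  { apply memv_entry, entry_pair; auto. }
  destruct (val (vpair vempty vempty) (pair (inr bot) rf)) as [q1 H1].
  { apply memv_entry, entry_pair; auto. }
  pose proof (Hinj vempty (vpair vempty vempty) s (pair q0 q1)
    (and_intro _ _ _ _ H0 H1)) as Heq.
  apply eqv_sym, eqv_unfold in Heq as [Heq _].
  destruct (Heq (inl bot) vempty) as (v & Hv & _); [apply entry_pair; auto |].
  exact (entry_empty _ _ Hv).
Qed.

Theorem corollary10 :
  (consistent CZF -> consistent (extend CZF injective_iff_singleton)) /\
  (consistent CZF -> ~ proves CZF enough_injectives).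
Proof.
  split; intros _ H.
  - apply realized_prv in H as [e He].
    + exact (He (fun _ => vempty)).
    + intros psi [Hpsi | ->];
        [now apply realized_CZF | exact realized_injective_iff_singleton].
  - apply enough_injectives_unrealized; revert H.
    apply realized_prv; exact realized_CZF.
Qed.
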